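(* Assume that there exist constants $a>0$, $K_1\ge1$ and $K_2\ge1$ such that $$\mathbb E\big[\exp(a\,G_{X_1}(X_1))\big]\le K_1\quad\text{and}\quad\mathbb E\big[\exp(a\,G_\varepsilon(\varepsilon))\big]\le K_2.$$ Let $$K=\frac{2}{e^2}\left(K_1+K_2\sum_{i=2}^n\Big(\frac{K_{n-i}(\rho)}{K_{n-1}(\rho)}\Big)^2\right)\quad\text{and}\quad\Delta=\frac{a}{K_{n-1}(\rho)}.$$ Then, for any $t\in[0,\Delta)$, $$\mathbb E[e^{\pm tS_n}]\le\exp\left(\frac{t^2K\Delta^{-2}}{1-t\Delta^{-1}}\right).$$ Consequently, for any $x>0$, $$\mathbb P(\pm S_n\ge x)\le\exp\left(-\frac{(x\Delta)^2}{2K(1+\sqrt{1+x\Delta/K})+x\Delta}\right)\le\exp\left(-\frac{(x\Delta)^2}{4K+2x\Delta}\right).$$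
   Context: $(\mathcal X,d)$ and $(\mathcal Y,\delta)$ are complete separable metric spaces; $(\varepsilon_i)_{i\ge1}$ is a sequence of iid $\mathcal Y$-valued random variables; $X_1$ is an $\mathcal X$-valued random variable independent of $(\varepsilon_i)_{i\ge2}$. The Markov chain is $X_n=F(X_{n-1},\varepsilon_n)$ for $n\ge2$, where $F:\mathcal X\times\mathcal Y\to\mathcal X$ is measurable and satisfies, for some $\rho\in[0,1)$ and $C>0$, $\mathbb E[d(F(x,\varepsilon_1),F(x',\varepsilon_1))]\le\rho\,d(x,x')$ for all $x,x'\in\mathcal X$, and $d(F(x,y),F(x,y'))\le C\,\delta(y,y')$ for all $x\in\mathcal X$, $y,y'\in\mathcal Y$. Fix $n\ge1$ and $f:\mathcal X^n\to\mathbb R$ with $|f(x_1,\ldots,x_n)-f(x_1',\ldots,x_n')|\le d(x_1,x_1')+\cdots+d(x_n,x_n')$, and let $S_n=f(X_1,\ldots,X_n)-\mathbb E[f(X_1,\ldots,X_n)]$. Let $P_{X_1}$ be the law of $X_1$, $P_\varepsilon$ the common law of the $\varepsilon_k$'s, $G_{X_1}(x)=\int d(x,x')P_{X_1}(dx')$, $G_\varepsilon(y)=\int C\,\delta(y,y')P_\varepsilon(dy')$; $G_\varepsilon(\varepsilon)$ denotes a random variable distributed as $G_\varepsilon(\varepsilon_k)$. For $k\in\mathbb N$, $K_k(\rho)=1+\rho+\cdots+\rho^k$ (these are distinct from the constants $K_1,K_2,K$ of the claim). Statements with $\pm$ hold for each of the two signs. *)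

(* Defs.v *)
From HB Require Import structures.
From mathcomp Require Import all_boot all_order all_algebra finmap.
From mathcomp Require Import all_classical all_reals all_analysis.

Set Implicit Arguments.
Unset Strict Implicit.
Unset Printing Implicit Defensive.

Import Order.TTheory GRing.Theory Num.Theory.
Import numFieldNormedType.Exports.

Local Open Scope classical_set_scope.
Local Open Scope ring_scope.

(* Complete separable metric spaces with their Borel sigma-algebra. The base
   point comes with completeType and measurableType; it costs no generality for
   a space in which a random variable takes its values. *)
HB.mixin Record isSeparableBorel (d : measure_display) (R : numDomainType) T
    & Metric R T & Complete T & Measurable d T := {
  separableT : exists2 D : set T, countable D & dense D ;
  measurable_borelE : @measurable d T = <<s @open T >>
}.

#[short(type="polishMetricType")]
HB.structure Definition PolishMetric (d : measure_display) (R : numDomainType) :=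
  {T of Metric R T & Complete T & Measurable d T & isSeparableBorel d R T}.

Section independence.
Context (d d' d'' : measure_display) (T : measurableType d)
  (S : measurableType d') (S' : measurableType d'') (R : realType)
  (P : probability T R).
Variables (I : choiceType) (D : set I).

Definition independent_RVs (Z : I -> {RV P >-> S}) :=
  forall (J : {fset I}) (B : I -> set S),
    [set` J] `<=` D -> (forall i, i \in J -> measurable (B i)) ->
    P (\bigcap_(i in [set` J]) Z i @^-1` B i) =
      (\prod_(i <- J) P (Z i @^-1` B i))%E.

Definition iid (Z : I -> {RV P >-> S}) :=
  independent_RVs Z /\
  (forall i j, D i -> D j -> forall B : set S, measurable B ->
    distribution P (Z i) B = distribution P (Z j) B).

Definition g_sigma_algebra_family (Z : I -> {RV P >-> S}) : set (set T) :=
  <<s \bigcup_(i in D) g_sigma_algebra_preimage (Z i) >>.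

Definition independent_of_family (V : {RV P >-> S'}) (Z : I -> {RV P >-> S}) :=
  forall A B : set T, g_sigma_algebra_preimage V A ->
    g_sigma_algebra_family Z B -> P (A `&` B) = (P A * P B)%E.

End independence.

Section constants.
Context (R : realType).

Definition Kgeom (rho : R) (k : nat) : R := \sum_(0 <= i < k.+1) rho ^+ i.

Definition Kmoment (rho K1 K2 : R) (n : nat) : R :=
  2 / expR 1 ^+ 2 *
  (K1 + K2 * \sum_(2 <= i < n.+1) (Kgeom rho (n - i) / Kgeom rho n.-1) ^+ 2).

Definition Delta_ (rho a : R) (n : nat) : R := a / Kgeom rho n.-1.

End constants.

(* Extended-real valued: no integrability of the distance is presupposed. *)
Definition G_X1 (d : measure_display) (R : realType)
    (S : polishMetricType d R) (mu : probability S R) (x : S) : \bar R :=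
  (\int[mu]_x' (mdist x x')%:E)%E.

Definition G_eps (d : measure_display) (R : realType)
    (S : polishMetricType d R) (C : R) (mu : probability S R) (y : S) : \bar R :=
  (\int[mu]_y' (C * mdist y y')%:E)%E.

Section functional.
Context (d d' : measure_display) (R : realType) (T : measurableType d)
  (P : probability T R) (S : measurableType d').

(* f (X_1, ..., X_n): the index of X starts at 1, that of the tuple at 0. *)
Definition chain_fun (n : nat) (f : n.-tuple S -> R) (X : nat -> {RV P >-> S})
    (w : T) : R :=
  f [tuple X i.+1 w | i < n].

(* The expectation is finite under the hypotheses of the theorem, so that
   fine loses nothing. *)
Definition centered (n : nat) (f : n.-tuple S -> R) (X : nat -> {RV P >-> S})
    (w : T) : R :=
  chain_fun f X w - fine ('E_P[chain_fun f X])%E.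

End functional.

(* Main.v *)
From HB Require Import structures.
Require Import Defs.
From mathcomp Require Import all_boot all_order all_algebra finmap.
From mathcomp Require Import all_classical all_reals all_analysis.
From mathcomp Require Import measurable_realfun ring lra.

Set Implicit Arguments.
Unset Strict Implicit.
Unset Printing Implicit Defensive.

Import Order.TTheory GRing.Theory Num.Theory.
Import numFieldNormedType.Exports.

Local Open Scope classical_set_scope.
Local Open Scope ring_scope.

(** The functional f(X_1, ..., X_n) is averaged over the noises eps_n, ...,
    eps_2 one after the other, starting with the last one, and finally over
    X_1. Averaging over eps_(k+1) turns a function of X_1, ..., X_(k+1) that is
    1-Lipschitz in X_1, ..., X_k and c-Lipschitz in X_(k+1) into a function of
    X_1, ..., X_k that is (1 + rho c)-Lipschitz in X_k, because F contracts in
    mean ([integrate_last_lipschitz]). Started from c = 1, the recursion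
    produces the constants [Kgeom rho (n - k)].

    Each averaging costs a factor in the exponential moment. If psi is
    L-Lipschitz for the distance C delta, then psi(y) differs from its mean by
    at most L G(y). For 0 <= q < 1 and |u| <= q v,
      e^u <= 1 + u + (2 / e^2) (q^2 / (1 - q)) e^v,
    since v^l / l! <= (2 / e^2) e^v as soon as l >= 2. Taking v = a G(y) and
    integrating, the linear term vanishes and the moment hypothesis bounds the
    last one ([lipschitz_mgf]); 1 + z <= e^z then makes the factors
    multiplicative over the steps. Their product is the announced bound
    ([chain_mgf]).

    To average over eps_(k+1) alone, the sample space is endowed with the
    sigma-algebra generated by X_1, eps_2, ..., eps_k. It is independent of
    eps_(k+1) by Dynkin's theorem ([sigma_past_independent]), and Tonelli's
    theorem applies to functions of a sample point and a noise value
    ([independent_tonelli_le]); this replaces conditional expectations. All the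
    functions met are Lipschitz in finitely many coordinates, hence measurable
    by separability ([lipschitz_comp_measurable]).

    The induction centers at the number m obtained by the successive averages,
    not at the expectation. The two agree: an exponential moment of Z - m that
    is 1 + O(tau^2) on both sides of 0 forces E[Z] = m
    ([integral_of_quadratic_mgf]), so that no Fubini theorem for signed
    functions is involved.

    The deviation inequality is Chernoff's bound at the minimizer of the
    exponent ([bernstein_exponentE]). *)

(** * Exponential estimates *)

Section exponential_bounds.
Context {R : realType}.
Implicit Types (u v q s x y k : R) (l N : nat).

(** With x = v / l in x <= e^(x - 1), v^l <= l^l e^(v - l). It remains that
    l^l e^(-l) / l! is at most its value 2 / e^2 at l = 2; it decreases in l
    because (1 + 1/l)^l <= e. *)
Lemma exprn_fact_le_expR l v : (2 <= l)%N -> 0 <= v ->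
  v ^+ l / l`!%:R <= 2 / expR 1 ^+ 2 * expR v.
Proof.
move=> l2 v0; have l0 : (0 < l%:R :> R) by rewrite ltr0n (leq_trans _ l2).
have vl : v ^+ l <= l%:R ^+ l * expR (v - l%:R).
  have -> : v - l%:R = l%:R * (v / l%:R - 1) by field; rewrite gt_eqF.
  rewrite expRM_natl -exprMn lerXn2r ?nnegrE ?mulr_ge0 ?expR_ge0 ?(ltW l0)//.
  rewrite mulrC -ler_pdivrMr//.
  by apply: le_trans (expR_ge1Dx _); rewrite addrC subrK.
have ll : (l%:R ^+ l / l`!%:R : R) <= 2 / expR 1 ^+ 2 * expR l%:R.
  elim: l l2 {vl l0} => // -[//|[_ _|l IH _]].
    by rewrite -expRM_natl mulr1 mulfVK ?gt_eqF ?expR_gt0// !factS fact0 expr2; lra.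
  have {}IH := IH isT; set m := l.+2 in IH *.
  have m0 : (0 < m%:R :> R) by rewrite ltr0n.
  (* the ratio of two consecutive terms is (1 + 1/m)^m / e *)
  have step : (m.+1%:R ^+ m : R) <= expR 1 * m%:R ^+ m.
    have -> : (m.+1%:R : R) = (1 + m%:R^-1) * m%:R.
      by rewrite mulrDl mul1r mulVf ?gt_eqF// -natr1 addrC.
    rewrite exprMn ler_wpM2r ?exprn_ge0// ?(ltW m0)//.
    rewrite -[in leRHS](@divff _ m%:R) ?gt_eqF//.
    rewrite expRM_natl lerXn2r ?nnegrE ?addr_ge0 ?expR_ge0 ?invr_ge0 ?(ltW m0)//.
    exact: expR_ge1Dx.
  have mf : (0 < m`!%:R :> R) by rewrite ltr0n fact_gt0.
  rewrite factS natrM exprS -mulf_div divff ?mul1r ?pnatr_eq0//.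
  rewrite -[m.+1 in leRHS]addn1 natrD expRD mulrA.
  apply: le_trans (_ : expR 1 * (m%:R ^+ m / m`!%:R) <= _).
    by rewrite mulrA ler_wpM2r// invr_ge0 ltW.
  by rewrite mulrC ler_wpM2r ?expR_ge0.
apply: le_trans (_ : l%:R ^+ l / l`!%:R * expR (v - l%:R) <= _).
  by rewrite mulrAC ler_wpM2r// invr_ge0.
rewrite expRB; apply: le_trans (ler_wpM2r _ ll) _.
  by rewrite divr_ge0 ?expR_ge0.
by rewrite -[leLHS]mulrA [X in _ * X <= _]mulrC divfK ?gt_eqF ?expR_gt0.
Qed.

(** The terms of order at least 2 of the exponential series of u are bounded by
    those of a geometric series in q, times (2 / e^2) e^v. *)
Lemma expR_le_linear_geometric u v q : 0 <= v -> 0 <= q -> q < 1 ->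
  `|u| <= q * v ->
  expR u <= 1 + u + 2 / expR 1 ^+ 2 * (q ^+ 2 / (1 - q)) * expR v.
Proof.
move=> v0 q0 q1 uqv; set c := 2 / expR 1 ^+ 2.
have c0 : 0 <= c by rewrite divr_ge0// exprn_ge0// expR_ge0.
rewrite /expR; apply: limr_le; first exact: is_cvg_series_exp_coeff.
near=> N.
have : (2 <= N)%N by near: N; exists 2%N.
move=> N2.
have -> : N = (N - 2).+2 by rewrite -addn2 subnK.
rewrite /series/= big_nat_recl// big_nat_recl//= /exp_coeff/= expr0 expr1.
rewrite !factS fact0 !divr1 addrA lerD2l big_mkord.
apply: (@le_trans _ _ (\sum_(i < (N - 2)%N) c * expR v * q ^+ i.+2)).
  apply: ler_sum => i _; apply: le_trans (ler_norm _) _.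
  rewrite normrM normrX (ger0_norm (x:=_^-1)) ?invr_ge0//.
  apply: (@le_trans _ _ ((q * v) ^+ i.+2 / i.+2`!%:R)).
    by rewrite ler_wpM2r ?invr_ge0// lerXn2r ?nnegrE ?mulr_ge0.
  rewrite exprMn -[leLHS]mulrA [leLHS]mulrC ler_wpM2r ?exprn_ge0//.
  exact: exprn_fact_le_expR.
rewrite -mulr_sumr [leRHS]mulrAC ler_wpM2l ?expR_ge0 ?mulr_ge0//.
under eq_bigr do rewrite -addn2 exprD.
rewrite -mulr_suml [leLHS]mulrC ler_wpM2l ?exprn_ge0//.
rewrite -[leRHS]mul1r ler_pdivlMr ?subr_gt0//.
have := subrX1 q (N - 2); have : 0 <= q ^+ (N - 2) by rewrite exprn_ge0.
set S := \sum_(i < _) _ => q' e; lra.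
Unshelve. all: by end_near. Qed.

End exponential_bounds.

Section bernstein_optimisation.
Context {R : realType}.
Implicit Types K y : R.

(** With s = t / Delta and y = x Delta, Chernoff's exponent is
    - s y + K s^2 / (1 - s). Its derivative vanishes when
    (1 - s)^(-2) = 1 + y / K, that is s = 1 - 1 / r; since y = K (r^2 - 1), both
    sides then equal - K (r - 1)^2. *)
Lemma bernstein_exponentE K y : 0 < K -> 0 < y ->
  let r := Num.sqrt (1 + y / K) in
  [/\ 0 < 1 - r^-1, 1 - r^-1 < 1 &
   - (1 - r^-1) * y + K * (1 - r^-1) ^+ 2 / (1 - (1 - r^-1)) =
   - (y ^+ 2 / (2 * K * (1 + r) + y))].
Proof.
move=> K0 y0 r; have yK : 0 < y / K by rewrite divr_gt0.
have r1 : 1 < r by rewrite -sqrtr1 ltr_sqrt ?ltrDl// addr_gt0.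
have r0 : 0 < r := lt_trans ltr01 r1.
have yE : y = K * (r ^+ 2 - 1).
  by rewrite sqr_sqrtr ?addr_ge0 ?ltW// addrAC subrr add0r mulrC divfK ?gt_eqF.
split.
- by rewrite subr_gt0 invf_lt1.
- by rewrite ltrBlDr ltrDl invr_gt0.
clearbody r; rewrite subKr invrK.

have -> : 2 * K * (1 + r) + y = K * (1 + r) ^+ 2 by rewrite yE; ring.
rewrite yE; field.
by rewrite !gt_eqF ?addr_gt0.
Qed.

(** From sqrt(1 + z) <= 1 + z / 2. *)
Lemma bernstein_simplify K y : 0 < K -> 0 < y ->
  y ^+ 2 / (4 * K + 2 * y) <=
  y ^+ 2 / (2 * K * (1 + Num.sqrt (1 + y / K)) + y).
Proof.
move=> K0 y0; have yK : 0 < y / K by rewrite divr_gt0.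
set r : R := Num.sqrt _; have r0 : 0 <= r := sqrtr_ge0 _.
have K2 : 0 <= K * r by rewrite mulr_ge0 ?(ltW K0).
have rle : r <= 1 + y / K / 2.
  rewrite -[leRHS]ger0_norm; last by lra.
  have -> : `|1 + y / K / 2| = Num.sqrt ((1 + y / K / 2) ^+ 2) by rewrite sqrtr_sqr.
  have -> : (1 + y / K / 2) ^+ 2 = 1 + y / K + (y / K / 2) ^+ 2.
    by field; rewrite gt_eqF.
  by rewrite ler_wsqrtr// lerDl sqr_ge0.
have : K * r <= K * (1 + y / K / 2) by rewrite ler_wpM2l ?(ltW K0).
have -> : K * (1 + y / K / 2) = K + y / 2 by field; rewrite gt_eqF.
clearbody r => Kr.
by rewrite ler_wpM2l ?sqr_ge0// lef_pV2 ?posrE; lra.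
Qed.

End bernstein_optimisation.

(** * Measurability of Lipschitz functions *)

Section lipschitz_measurable.
Context (d d' : measure_display) (R : realType) (S : polishMetricType d R)
  (U : measurableType d').

(** The density of a countable set in the form used for approximations: the
    sequence may repeat values, and takes the base point at unused indices. *)
Lemma dense_sequence : exists e : nat -> S,
  forall x r, 0 < r -> exists k, mdist x (e k) < r.
Proof.
have [D /countable_injP[f finj] dD] := @separableT d R S.
exists (fun k => xget point [set x | D x /\ f x = k]) => x r r0.
have [|y [xy Dy]] := dD (ball x r)° _ (open_interior _).
  by exists x; apply: nbhsx_ballx.
exists (f y); case: xgetP => [z _ [Dz fz]|/(_ y)]; last by case.
have -> : z = y by apply: finj => //; rewrite inE.
by have := interior_subset xy; rewrite ballEmdist.
Qed.

Lemma measurable_mdist (q : S) : measurable_fun setT (mdist q).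
Proof.
apply: (measurability _ (RGenInftyO.measurableE R)).
move=> _ [_ [x ->] <-]; rewrite setTI.
rewrite measurable_borelE; apply: sub_sigma_algebra.
rewrite openE => y; rewrite /= in_itv/= => qy.
apply/nbhs_ballP; exists (x - mdist q y) => /=; first by rewrite subr_gt0.
move=> z; rewrite ballEmdist/= => yz; rewrite in_itv/=.
by apply: le_lt_trans (metric_triangle _ y _) _; rewrite -ltrBrDl.
Qed.

(** A c-Lipschitz phi is the infimum over q of phi(q) + c d(q, .), and q may be
    restricted to a dense set of configurations, indexed by finite sequences of
    integers. Only the distances to fixed points have to be measurable, so that
    no measurability on the space of configurations is needed. *)
Lemma lipschitz_comp_measurable (I : eqType) (r : seq I) (c : R)
    (phi : (I -> S) -> R) (Z : I -> U -> S) : 0 <= c ->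
  (forall h h', `|phi h - phi h'| <= c * \sum_(i <- r) mdist (h i) (h' i)) ->
  (forall i, i \in r -> measurable_fun setT (Z i)) ->
  measurable_fun setT (fun u => phi (Z ^~ u)).
Proof.
move=> c0 lip mZ; have [e eP] := dense_sequence.
pose q (s : seq nat) i := e (nth 0%N s (index i r)).
apply: (measurability _ (RGenInftyO.measurableE R)).
move=> _ [_ [x ->] <-]; rewrite setTI.
pose g s u := phi (q s) + c * \sum_(i <- r) mdist (q s i) (Z i u).
have mg s : measurable_fun setT (g s).
  apply: measurable_funD => //; apply: measurable_funM => //.
  rewrite /= [X in measurable_fun _ X](_ : _ = fun u =>
    \sum_(i <- r) (if i \in r then mdist (q s i) (Z i u) else 0)); last first.
    by apply/funext => u; apply: eq_big_seq => i ->.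
  apply: measurable_sum => i; case: (boolP (i \in r)) => ir; last exact: measurable_cst.
  by apply: measurableT_comp; [exact: measurable_mdist|exact: mZ].
(* phi < x if and only if one of the countably many g s is < x *)
rewrite [X in measurable X](_ : _ = \bigcup_s (g s @^-1` `]-oo, x[)).
  apply: countable_bigcupT_measurable => // s.
  by rewrite -[X in measurable X]setTI; apply: mg.
apply/seteqP; split => u /=; last first.
  move=> [s _] /=; rewrite !in_itv/=; apply: le_lt_trans.
  rewrite /g -lerBlDl; apply: le_trans (ler_norm _) _.
  by rewrite distrC; exact: lip.
rewrite in_itv/= => ux.
pose eta := (x - phi (Z ^~ u)) / (2 * c * (size r)%:R + 1).
have D0 : 0 < 2 * c * (size r)%:R + 1 by rewrite ltr_wpDl// !mulr_ge0.
have eta0 : 0 < eta by rewrite divr_gt0// subr_gt0.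
pose s := [seq projT1 (cid (eP (Z i u) _ eta0)) | i <- r].
exists s => //=; rewrite in_itv/=.
(* the configuration s approximates Z at precision eta, chosen to absorb the
   error of g s, which is at most 2 c (size r) eta *)
have sum_le : \sum_(i <- r) mdist (q s i) (Z i u) <= (size r)%:R * eta.
  rewrite -[in leRHS]sum1_size natr_sum mulr_suml.
  rewrite big_seq [leRHS]big_seq; apply: ler_sum => i ir; rewrite mul1r.
  rewrite /q (nth_map i) ?index_mem// nth_index//.
  by case: cid => k /= /ltW; rewrite metric_sym.
rewrite /g; apply: (@le_lt_trans _ _ (phi (Z ^~ u) + 2 * c * ((size r)%:R * eta))).
  have := le_trans (ler_norm _) (lip (q s) (Z ^~ u)).
  have := ler_wpM2l c0 sum_le; lra.
have : eta * (2 * c * (size r)%:R + 1) = x - phi (Z ^~ u).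
  by rewrite divfK// gt_eqF.
by lra.
Qed.

End lipschitz_measurable.

(** * Exponential moments of Lipschitz functions of one variable *)

Lemma integral_probability_cst (d : measure_display) (R : realType)
  (T : measurableType d) (P : probability T R) (r : \bar R) :
  (\int[P]_w r = r)%E.
Proof.
rewrite integral_cst// [X in (_ * X)%E](_ : _ = 1%E) ?mule1//.
exact: probability_setT.
Qed.

Lemma Rintegral_probability_cst (d : measure_display) (R : realType)
  (T : measurableType d) (P : probability T R) (r : R) : \int[P]_w r = r.
Proof. by rewrite /Rintegral integral_probability_cst. Qed.

Lemma le_norm_RintegralB (d : measure_display) (R : realType)
    (T : measurableType d) (mu : {measure set T -> \bar R}) (f g h : T -> R) :
  mu.-integrable setT (EFin \o f) -> mu.-integrable setT (EFin \o g) ->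
  mu.-integrable setT (EFin \o h) -> (forall x, `|f x - g x| <= h x) ->
  `|\int[mu]_x f x - \int[mu]_x g x| <= \int[mu]_x h x.
Proof.
move=> intf intg inth fgh; rewrite -RintegralB//.
have intB : mu.-integrable setT (EFin \o (fun x => f x - g x)).
  by apply: eq_integrable (integrableB measurableT intf intg).
apply: le_trans (le_normr_Rintegral measurableT intB) _.
by apply: le_Rintegral => //; exact: (integrable_norm intB).
Qed.

Section lipschitz_exponential_moment.
Context (dT d : measure_display) (R : realType) (T : measurableType dT)
  (P : probability T R) (S : polishMetricType d R) (Z : {RV P >-> S})
  (C a M : R).
Hypotheses (C_gt0 : 0 < C) (a_gt0 : 0 < a).
Local Notation mu := (distribution P Z).
Hypothesis moment :
  (\int[P]_w expeR (a%:E * G_eps C mu (Z w)) <= M%:E)%E.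

Lemma lipschitz_measurable (L : R) (psi : S -> R) : 0 <= L ->
  (forall y y', `|psi y - psi y'| <= L * mdist y y') ->
  measurable_fun setT psi.
Proof.
move=> L0 lip.
apply: (@lipschitz_comp_measurable _ _ _ _ S unit [:: tt] L
  (fun h => psi (h tt)) (fun _ => id)) => // h h'.
by rewrite big_seq1.
Qed.

(** If G were infinite everywhere, so would be its exponential moment; and
    integrability of the distance to one point gives that to every point by the
    triangle inequality. *)
Lemma integrable_mdist y : mu.-integrable setT (EFin \o mdist y).
Proof.
have mdist_m y0 : measurable_fun setT (EFin \o mdist (y0 : S)).
  by apply/measurable_EFinP; exact: measurable_mdist.
have [y0 Gy0] : exists y0, (G_eps C mu y0 < +oo)%E.
  apply: contrapT => /forallNP G_infty; move: moment.
  under eq_integral => w _.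
    have /negP := G_infty (Z w); rewrite -leNgt leye_eq => /eqP ->.
    rewrite gt0_muley ?lte_fin//.
    over.
  have -> : (\int[P]_w +oo = +oo :> \bar R)%E.
    exact: integral_probability_cst.
  by rewrite leye_eq.
have int0 : mu.-integrable setT (EFin \o mdist y0).
  apply/integrableP; split; first exact: mdist_m.
  move: Gy0; rewrite /G_eps.
  under eq_integral do rewrite EFinM.
  rewrite ge0_integralZl//; last 3 first.
    exact: mdist_m.
    by move=> z _; rewrite lee_fin mdist_ge0.
    by rewrite lee_fin ltW.
  under [in X in _ -> X]eq_integral do rewrite /= ger0_norm ?mdist_ge0//.
  have := leey (\int[mu]_z (mdist y0 z)%:E)%E.
  rewrite le_eqVlt => /predU1P[->|//].
  by rewrite gt0_muley ?lte_fin.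
have intD : mu.-integrable setT (EFin \o (fun z => mdist y y0 + mdist y0 z)).
  have := integrableD measurableT
    (@finite_measure_integrable_cst _ _ _ mu _ (mdist y y0) measurableT) int0.
  by apply: eq_integrable.
apply: le_integrable intD => //.
move=> z _; rewrite lee_fin !ger0_norm ?addr_ge0 ?mdist_ge0//.
exact: metric_triangle.
Qed.

Lemma lipschitz_integrable (L : R) (psi : S -> R) : 0 <= L ->
  (forall y y', `|psi y - psi y'| <= L * mdist y y') ->
  mu.-integrable setT (EFin \o psi).
Proof.
move=> L0 lip; pose y0 : S := point.
have intD : mu.-integrable setT (EFin \o (fun z => `|psi y0| + L * mdist y0 z)).
  have := integrableD measurableT
    (@finite_measure_integrable_cst _ _ _ mu _ `|psi y0| measurableT)
    (integrableZl measurableT L (integrable_mdist y0)).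
  by apply: eq_integrable.
apply: le_integrable intD => //.
  by apply/measurable_EFinP; exact: (lipschitz_measurable L0).
move=> z _; rewrite lee_fin [leRHS]ger0_norm; last first.
  by rewrite addr_ge0// mulr_ge0// mdist_ge0.
have -> : psi z = psi y0 + (psi z - psi y0) by rewrite addrC subrK.
apply: le_trans (ler_normD _ _) _.
by rewrite lerD2l (le_trans (lip _ _))// metric_sym.
Qed.

(** The real-valued version of [G_eps], finite everywhere by the above. *)
Let v y := \int[mu]_z (C * mdist y z).

Lemma integrable_scaled_mdist y : mu.-integrable setT (EFin \o (fun z => C * mdist y z)).
Proof.
by have := integrableZl measurableT C (integrable_mdist y); apply: eq_integrable.
Qed.

Let G_epsE y : G_eps C mu y = (v y)%:E.
Proof.
rewrite /v /Rintegral fineK//; apply: integrable_fin_num => //.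
exact: integrable_scaled_mdist.
Qed.

Let v_ge0 y : 0 <= v y.
Proof. by apply: Rintegral_ge0 => z _; rewrite mulr_ge0 ?mdist_ge0 ?(ltW C_gt0). Qed.

Let v_measurable : measurable_fun setT v.
Proof.
apply: (lipschitz_measurable (ltW C_gt0)) => y y'.
rewrite -[C * mdist y y'](Rintegral_probability_cst mu).
apply: le_norm_RintegralB; [exact: integrable_scaled_mdist..| |].
  exact: finite_measure_integrable_cst.
move=> z; rewrite -mulrBr normrM gtr0_norm// ler_wpM2l ?(ltW C_gt0)//.
have := metric_triangle y y' z; have := metric_triangle y' y z.
by rewrite ler_norml (metric_sym y' y); lra.
Qed.

Let int_expR_v : (\int[mu]_y (expR (a * v y))%:E <= M%:E)%E.
Proof.
rewrite ge0_integral_distribution//; last first.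
  apply/measurable_EFinP; apply: measurableT_comp => //.
  exact: measurable_funM.
by apply: le_trans moment; under [leRHS]eq_integral do rewrite G_epsE.
Qed.

(** |psi - m| <= L v by averaging the Lipschitz bound over the second variable;
    hence |tau (psi - m)| <= q a v, and the pointwise bound
    [expR_le_linear_geometric] can be integrated. *)
Lemma lipschitz_mgf (L q tau : R) (psi : S -> R) : 0 <= L -> 0 <= q -> q < 1 ->
  `|tau| * L <= q * a ->
  (forall y y', `|psi y - psi y'| <= L * (C * mdist y y')) ->
  (\int[mu]_y (expR (tau * (psi y - \int[mu]_z psi z)))%:E <=
   (expR (2 / expR 1 ^+ 2 * (q ^+ 2 / (1 - q)) * M))%:E)%E.
Proof.
move=> L0 q0 q1 tauL lip; set m := \int[mu]_z psi z.
have LC0 : 0 <= L * C by rewrite mulr_ge0 ?(ltW C_gt0).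
have lip' y y' : `|psi y - psi y'| <= L * C * mdist y y' by rewrite -mulrA.
have psi_int := lipschitz_integrable LC0 lip'.
have psi_m y : `|psi y - m| <= L * v y.
  rewrite -[psi y](Rintegral_probability_cst mu).
  rewrite /m -RintegralZl//; last exact: integrable_scaled_mdist.
  apply: le_norm_RintegralB => //; first exact: finite_measure_integrable_cst.
  by have := integrableZl measurableT L (integrable_scaled_mdist y); apply: eq_integrable.
set c := 2 / expR 1 ^+ 2 * (q ^+ 2 / (1 - q)).
have c0 : 0 <= c.
  by rewrite mulr_ge0// divr_ge0 ?exprn_ge0 ?expR_ge0// subr_ge0 ltW.
have mexp : measurable_fun setT (fun y => expR (a * v y)).
  by apply: measurableT_comp => //; exact: measurable_funM.
have int_exp : mu.-integrable setT (fun y => (expR (a * v y))%:E).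
  apply/integrableP; split; first exact/measurable_EFinP.
  under eq_integral do rewrite /= ger0_norm ?expR_ge0//.
  exact: le_lt_trans int_expR_v (ltry _).
have mpsi := lipschitz_measurable LC0 lip'.
have int_lin : mu.-integrable setT (EFin \o (fun y => 1 + tau * (psi y - m))).
  apply: eq_integrable (integrableD measurableT
    (@finite_measure_integrable_cst _ _ _ mu _ (1 - tau * m) measurableT)
    (integrableZl measurableT tau psi_int)) => // y _ /=.
  by congr EFin; rewrite mulrBr addrAC addrA.
have int_cexp : mu.-integrable setT (EFin \o (fun y => c * expR (a * v y))).
  by have := integrableZl measurableT c int_exp; apply: eq_integrable.
apply: (@le_trans _ _ (\int[mu]_y (1 + tau * (psi y - m) + c * expR (a * v y))%:E)%E).
  apply: ge0_le_integral => //.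
  - apply/measurable_EFinP; apply: measurableT_comp => //.
    by apply: measurable_funM => //; exact: measurable_funB.
  - by have /measurable_int := integrableD measurableT int_lin int_cexp.
  move=> y _; rewrite lee_fin; apply: expR_le_linear_geometric => //.
    by rewrite mulr_ge0 ?(ltW a_gt0).
  rewrite normrM mulrA; apply: le_trans (ler_wpM2l (normr_ge0 tau) (psi_m y)) _.
  by rewrite mulrA ler_wpM2r.
have -> : (\int[mu]_y (1 + tau * (psi y - m) + c * expR (a * v y))%:E =
    1 + c%:E * \int[mu]_y (expR (a * v y))%:E)%E.
  under eq_integral do rewrite EFinD.
  rewrite integralD//; congr (_ + _)%E; last first.
    by under eq_integral do rewrite EFinM; exact: integralZl.
  transitivity (\int[mu]_y ((1 - tau * m)%:E + tau%:E * (psi y)%:E))%E.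
    by apply: eq_integral => y _; rewrite -EFinM -EFinD; congr EFin; ring.
  rewrite integralD//; [|exact: finite_measure_integrable_cst|exact: integrableZl].
  rewrite integralZl// integral_probability_cst.
  have -> : (\int[mu]_y (psi y)%:E = m%:E)%E.
    by rewrite /m /Rintegral fineK//; exact: integrable_fin_num.
  by rewrite -EFinM -EFinD subrK.
apply: (@le_trans _ _ (1 + c%:E * M%:E)%E).
  by rewrite leeD2l// lee_wpmul2l.
by rewrite -EFinM -EFinD lee_fin expR_ge1Dx.
Qed.

End lipschitz_exponential_moment.

(** * Independence of the past and the next noise *)

Section independence_of_the_past.
Context (d d' d'' : measure_display) (T : measurableType d)
  (S : measurableType d') (S' : measurableType d'') (R : realType)
  (P : probability T R) (I : choiceType) (D : set I)
  (Z : I -> {RV P >-> S}) (V : {RV P >-> S'}).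
Implicit Types J : {fset I}.

(** Cylinder events determined by V and the finitely many Z i, i in J. They are
    taken in full product form, so that they are stable under intersection. *)
Definition past J : set (set T) :=
  [set A | exists A0 : set S', exists B : I -> set S,
    [/\ measurable A0, forall i, measurable (B i) &
        A = V @^-1` A0 `&` \bigcap_(i in [set` J]) Z i @^-1` B i]].

Lemma past_setI_closed J : setI_closed (past J).
Proof.
move=> _ _ [A [B [mA mB ->]]] [A' [B' [mA' mB' ->]]].
exists (A `&` A'), (fun i => B i `&` B' i); split => //.
- exact: measurableI.
- by move=> i; exact: measurableI.
by rewrite preimage_setI setIACA -bigcapI.
Qed.

Lemma past_setT J : past J setT.
Proof.
exists setT, (fun=> setT); split => //.
by rewrite preimage_setT setTI; apply/esym/seteqP; split.
Qed.

Lemma measurable_past J : past J `<=` measurable.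
Proof.
move=> _ [A [B [mA mB ->]]]; apply: measurableI.
  by rewrite -[X in measurable X]setTI; exact: measurable_funP.
apply: fin_bigcap_measurable => // i _.
by rewrite -[X in measurable X]setTI; exact: measurable_funP.
Qed.

Lemma measurable_sigma_past J : <<s past J >> `<=` measurable.
Proof.
apply: smallest_sub; first exact: sigma_algebra_measurable.
exact: measurable_past.
Qed.

Local Notation T_past J := (g_sigma_algebraType (past J)).

(** The identity, as a random variable with values in the sample space endowed
    with the coarser sigma-algebra; conditioning on the past amounts to
    considering its joint law with a later variable. *)
Definition to_past J : T -> T_past J := id.

Lemma measurable_to_past J : measurable_fun setT (to_past J).
Proof. by move=> _ A mA; rewrite setTI; exact: (@measurable_sigma_past J). Qed.

HB.instance Definition _ J :=
  isMeasurableFun.Build _ _ _ _ (to_past J) (@measurable_to_past J).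

Lemma measurable_past_initial J :
  measurable_fun setT (V : T_past J -> S').
Proof.
move=> _ A mA; rewrite setTI; apply: sub_sigma_algebra.
exists A, (fun=> setT); split => //.
by rewrite [X in _ `&` X](_ : _ = setT) ?setIT//; apply/seteqP; split.
Qed.

Lemma measurable_past_noise J i : i \in J ->
  measurable_fun setT (Z i : T_past J -> S).
Proof.
move=> iJ _ A mA; rewrite setTI; apply: sub_sigma_algebra.
exists setT, (fun j => if j == i then A else setT); split => //.
  by move=> j; case: ifP.
rewrite preimage_setT setTI; apply/seteqP; split => [w Aw j _ /=|w /(_ i iJ) /=].
  by case: eqP => // ->.
by rewrite eqxx.
Qed.

Hypotheses (Z_indep : independent_RVs D Z) (V_indep : independent_of_family D V Z).

(** On cylinder events the probability of an intersection with an event of Z k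
    is a product, by the two independence hypotheses; the two finite measures
    A |-> P (A n B) and A |-> P (B) P (A) then agree on the generated
    sigma-algebra. *)
Lemma sigma_past_independent J k : [set` J] `<=` D -> D k -> k \notin J ->
  forall A B, <<s past J >> A -> measurable B ->
  P (A `&` Z k @^-1` B) = (P A * P (Z k @^-1` B))%E.
Proof.
move=> JD Dk kJ A B pA mB.
have mZB : measurable (Z k @^-1` B).
  by rewrite -[X in measurable X]setTI; exact: measurable_funP.
have fB : 0 <= fine (P (Z k @^-1` B)) by rewrite fine_ge0// measure_ge0.
have PB : P (Z k @^-1` B) = (fine (P (Z k @^-1` B)))%:E.
  by rewrite fineK// fin_num_measure.
have Z_family (J' : {fset I}) (C : I -> set S) : [set` J'] `<=` D ->
    (forall i, i \in J' -> measurable (C i)) ->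
    g_sigma_algebra_family D Z (\bigcap_(i in [set` J']) Z i @^-1` C i).
  move=> J'D mC; rewrite /g_sigma_algebra_family.
  set G := \bigcup_(i in D) _.
  apply: (@fin_bigcap_measurable _ (g_sigma_algebraType G)) => // i iJ'.
  apply: sub_sigma_algebra; exists i; first exact: J'D.
  by exists (C i); [exact: mC|rewrite setTI].
have V_sigma C : measurable C -> g_sigma_algebra_preimage V (V @^-1` C).
  by move=> mC; exists C => //; rewrite setTI.
rewrite PB muleC.
apply: (g_sigma_algebra_measure_unique (past J) (@measurable_past J)
  (fun=> setT) (fun=> past_setT J) _ (mrestr P mZB) (mscale (NngNum fB) P)) => //.
- by rewrite bigcup_const.
- exact: past_setI_closed.
- move=> _ [A0 [C [mA0 mC ->]]].
  set E := V @^-1` A0 `&` _.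
  change (P (E `&` Z k @^-1` B) = (fine (P (Z k @^-1` B)))%:E * P E)%E.
  rewrite -PB /E {E}.
  (* the event of Z k is merged into the cylinder, as its coordinate k *)
  pose C' i := if i == k then B else C i.
  have mC' i : measurable (C' i) by rewrite /C'; case: ifP.
  have C'E : \bigcap_(i in [set` J]) Z i @^-1` C i =
             \bigcap_(i in [set` J]) Z i @^-1` C' i.
    apply: eq_bigcapr => i /= iJ; rewrite /C' ifF//.
    by apply: contraNF kJ => /eqP <-.
  have C'U : \bigcap_(i in [set` J]) Z i @^-1` C' i `&` Z k @^-1` B =
             \bigcap_(i in [set` (k |` J)%fset]) Z i @^-1` C' i.
    by rewrite set_fsetU1 bigcap_setU1 setIC /C' eqxx.
  have JkD : [set` (k |` J)%fset] `<=` D.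
    by rewrite set_fsetU1 => i [->//|]; exact: JD.
  rewrite C'E -setIA C'U V_indep; [|exact: V_sigma|exact: Z_family].
  rewrite V_indep; [|exact: V_sigma|exact: Z_family].
  rewrite !Z_indep// big_fsetU1//= /C' eqxx.
  by rewrite muleCA.
- move=> _; change (P (setT `&` Z k @^-1` B) < +oo)%E.
  by rewrite setTI PB ltry.
Qed.

End independence_of_the_past.

Section independent_tonelli.
Context (d d' d'' : measure_display) (T : measurableType d)
  (U : measurableType d') (S : measurableType d'') (R : realType)
  (P : probability T R) (W : {RV P >-> U}) (Z : {RV P >-> S}).
Hypothesis WZ_indep : forall A B, measurable A -> measurable B ->
  P (W @^-1` A `&` Z @^-1` B) = (P (W @^-1` A) * P (Z @^-1` B))%E.

(** By independence the joint law of W and Z is the product law. A bound of the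
    partial integrals is all that is asked for, as they are only estimated. *)
Lemma independent_tonelli_le (phi : U * S -> \bar R) (g : U -> \bar R) :
  measurable_fun setT phi -> (forall x, 0 <= phi x)%E ->
  measurable_fun setT g ->
  (forall u, \int[distribution P Z]_y phi (u, y) <= g u)%E ->
  (\int[P]_w phi (W w, Z w) <= \int[P]_w g (W w))%E.
Proof.
move=> mphi phi0 mg phig.
have int0 u : (0 <= \int[distribution P Z]_y phi (u, y))%E.
  exact: integral_ge0.
have g0 u : (0 <= g u)%E by exact: le_trans (phig u).
have mWZ : measurable_fun setT (fun w => (W w, Z w)).
  exact: measurable_fun_pair.
have -> : (\int[P]_w phi (W w, Z w) =
    \int[pushforward P (fun w => (W w, Z w))]_x phi x)%E.
  by rewrite ge0_integral_pushforward.
have -> : (\int[pushforward P (fun w => (W w, Z w))]_x phi x =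
    \int[distribution P W \x distribution P Z]_x phi x)%E.
  apply/esym/eq_measure_integral => A mA _.
  exact: product_measure_unique.
rewrite fubini_tonelli1//.
apply: (@le_trans _ _ (\int[distribution P W]_u g u)%E).
  apply: ge0_le_integral => //.
  - by move=> u _; exact: int0.
  - exact: measurable_fun_fubini_tonelli_F.
  - by move=> u _; exact: phig.
by rewrite ge0_integral_distribution.
Qed.

End independent_tonelli.

(** * Iterated averages along the Markov chain *)

Section geometric_constants.
Context {R : realType}.
Implicit Types (rho s r M : R) (k : nat).

Lemma KgeomS rho k : Kgeom rho k.+1 = 1 + rho * Kgeom rho k.
Proof.
rewrite /Kgeom big_nat_recl// expr0 mulr_sumr; congr (_ + _).
by apply: eq_bigr => i _; rewrite exprS.
Qed.

Lemma Kgeom_ge1 rho k : 0 <= rho -> 1 <= Kgeom rho k.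
Proof.
move=> rho0; rewrite /Kgeom big_nat_recl// expr0 lerDl.
by apply: sumr_ge0 => i _; rewrite exprn_ge0.
Qed.

Lemma Kgeom_gt0 rho k : 0 <= rho -> 0 < Kgeom rho k.
Proof. by move=> rho0; rewrite (lt_le_trans ltr01)// Kgeom_ge1. Qed.

Lemma Kgeom_le rho k l : 0 <= rho -> (k <= l)%N -> Kgeom rho k <= Kgeom rho l.
Proof.
move=> rho0 /subnK <-; elim: (l - k)%N => // m IH.
apply: le_trans IH _.
by rewrite addSn /Kgeom [leRHS]big_nat_recr//= lerDl exprn_ge0.
Qed.

(** The factor of step i has q = s r with r = K_(n-i) / K_(n-1) <= 1; the
    denominators are made uniform in i at no cost in the numerators. *)
Lemma ratio_exponent_le s r M : 0 <= s -> s < 1 -> 0 <= r -> r <= 1 -> 0 <= M ->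
  2 / expR 1 ^+ 2 * ((s * r) ^+ 2 / (1 - s * r)) * M <=
  2 / expR 1 ^+ 2 * (s ^+ 2 / (1 - s)) * (M * r ^+ 2).
Proof.
move=> s0 s1 r0 r1 M0.
have sr : s * r <= s by rewrite ler_piMr.
have -> : 2 / expR 1 ^+ 2 * (s ^+ 2 / (1 - s)) * (M * r ^+ 2) =
          2 / expR 1 ^+ 2 * ((s * r) ^+ 2 / (1 - s)) * M by rewrite exprMn; ring.
rewrite ler_wpM2r// ler_wpM2l ?divr_ge0 ?exprn_ge0 ?expR_ge0//.
rewrite ler_wpM2l ?exprn_ge0 ?mulr_ge0// lef_pV2 ?posrE ?subr_gt0//.
  by rewrite lerD2l lerN2.
exact: le_lt_trans sr s1.
Qed.

End geometric_constants.

Section markov_chain.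
Context (R : realType) (dT dX dY : measure_display)
  (T : measurableType dT) (P : probability T R)
  (X : polishMetricType dX R) (Y : polishMetricType dY R)
  (eps : nat -> {RV P >-> Y}) (Xn : nat -> {RV P >-> X})
  (F : X * Y -> X) (rho C : R).
Hypotheses (eps_iid : iid [set i | (1 <= i)%N] eps)
  (X1_indep : independent_of_family [set i | (2 <= i)%N] (Xn 1%N) eps)
  (Xn_chain : forall k, (2 <= k)%N -> forall w, Xn k w = F (Xn k.-1 w, eps k w))
  (F_meas : measurable_fun [set: X * Y] F)
  (rho_ge0 : 0 <= rho) (C_gt0 : 0 < C)
  (F_contract : forall x x' : X,
    ('E_P[fun w => mdist (F (x, eps 1%N w)) (F (x', eps 1%N w))]
      <= (rho * mdist x x')%:E)%E)
  (F_lip : forall (x : X) (y y' : Y),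
    mdist (F (x, y)) (F (x, y')) <= C * mdist y y').

Implicit Types (h : nat -> X) (phi : (nat -> X) -> R) (k i : nat).

Local Notation mu := (distribution P (eps 1%N)).

(** The noises that, together with X_1, determine X_1, ..., X_k: those of index
    2 to k. *)
Definition noise_times k : {fset nat} := seq_fset tt (iota 2 k.-1).

Local Notation past_upto k := (past (I := nat) eps (Xn 1%N) (noise_times k)).
Local Notation T_past k := (g_sigma_algebraType (past_upto k)).

Lemma mem_noise_times k i : (1 <= k)%N -> (i \in noise_times k) = (2 <= i <= k)%N.
Proof. by move=> k1; rewrite seq_fsetE mem_iota addSn add1n prednK. Qed.

Lemma measurable_chain_past k i : (1 <= k)%N -> (1 <= i <= k)%N ->
  measurable_fun setT (Xn i : T_past k -> X).
Proof.
move=> k1; elim: i => // -[_ _|i IH /andP[_ ik]].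
  exact: measurable_past_initial.
rewrite [X in measurable_fun _ X](_ : _ = fun w => F (Xn i.+1 w, eps i.+2 w)); last first.
  by apply/funext => w; rewrite Xn_chain.
apply: measurableT_comp => //; apply: measurable_fun_pair.
  by apply: IH; rewrite /= (ltnW ik).
by apply: measurable_past_noise; rewrite mem_noise_times.
Qed.

Lemma noise_past_independent k : (1 <= k)%N -> forall A B,
  measurable (A : set (T_past k)) -> measurable B ->
  P (A `&` eps k.+1 @^-1` B) = (P A * P (eps k.+1 @^-1` B))%E.
Proof.
move=> k1 A B mA mB.
apply: (@sigma_past_independent _ _ _ _ _ _ _ _ _ [set i | (2 <= i)%N] eps (Xn 1%N)
  _ _ (noise_times k)) => //.
- move=> J C' JD mC'; apply: (eps_iid.1) => // i /JD /=.
  exact: ltnW.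
- by move=> i /=; rewrite mem_noise_times// => /andP[].
- by rewrite mem_noise_times// ltnn andbF.
Qed.

Lemma integral_noise k (g : Y -> \bar R) : (1 <= k)%N ->
  (\int[distribution P (eps k)]_y g y = \int[mu]_y g y)%E.
Proof.
by move=> k1; apply: eq_measure_integral => A mA _; exact: (eps_iid.2).
Qed.

(** Histories are total sequences, of which only the terms 1 to k matter: this
    predicate forces phi to ignore the other ones. *)
Definition lipschitz_last c k phi := forall h h',
  `|phi h - phi h'| <=
  \sum_(1 <= i < k) mdist (h i) (h' i) + c * mdist (h k) (h' k).

Definition extend h k x i := if i == k then x else h i.

(** The conditional expectation of phi (X_1, ..., X_(k+1)) given
    (X_1, ..., X_k) = (h 1, ..., h k). *)
Definition integrate_last k phi h :=
  \int[mu]_y phi (extend h k.+1 (F (h k, y))).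

Lemma extend_lipschitz c k phi h : 0 <= c -> lipschitz_last c k.+1 phi ->
  forall x x', `|phi (extend h k.+1 x) - phi (extend h k.+1 x')| <= c * mdist x x'.
Proof.
move=> c0 lip x x'; apply: le_trans (lip _ _) _.
rewrite /extend eqxx big_nat big1 ?add0r// => i /andP[_ ik].
by rewrite ltn_eqF// mdistxx.
Qed.

(** Measurability is asked of the coordinates 1 to k only: for k in the past,
    the later ones are not measurable. *)
Lemma lipschitz_last_measurable (d : measure_display) (U : measurableType d)
    c k phi (Z : nat -> U -> X) : (1 <= k)%N -> 0 <= c ->
  lipschitz_last c k phi ->
  (forall i, (1 <= i <= k)%N -> measurable_fun setT (Z i)) ->
  measurable_fun setT (fun u => phi (Z ^~ u)).
Proof.
move=> k1 c0 lip mZ.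
apply: (@lipschitz_comp_measurable _ _ _ _ _ _ (index_iota 1 k.+1) (1 + c)).
- by rewrite addr_ge0.
- move=> h h'; apply: le_trans (lip h h') _.
  rewrite big_nat_recr//= mulrDl mul1r mulrDr.
  set S := \sum_(_ <= _ < _) _.
  have S0 : 0 <= S by apply: sumr_ge0 => i _; exact: mdist_ge0.
  have := mulr_ge0 c0 S0; have := mdist_ge0 (h k) (h' k); lra.
by move=> i; rewrite mem_index_iota ltnS; exact: mZ.
Qed.

Variables (a K1 K2 : R).
Hypotheses (a_gt0 : 0 < a) (K2_ge1 : 1 <= K2)
  (moment_X1 :
    (\int[P]_w expeR (a%:E * G_X1 (distribution P (Xn 1%N)) (Xn 1%N w))
      <= K1%:E)%E)
  (moment_eps :
    (\int[P]_w expeR (a%:E * G_eps C (distribution P (eps 1%N)) (eps 1%N w))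
      <= K2%:E)%E).

(** In the next noise, phi is Lipschitz because F is; this is what allows the
    one-variable estimates to be applied to the law of the noise. *)
Lemma extend_noise_lipschitz c k phi h : 0 <= c -> lipschitz_last c k.+1 phi ->
  forall y y', `|phi (extend h k.+1 (F (h k, y))) -
                 phi (extend h k.+1 (F (h k, y')))| <= c * (C * mdist y y').
Proof.
move=> c0 lip y y'; apply: le_trans (extend_lipschitz _ c0 lip _ _) _.
by rewrite ler_wpM2l.
Qed.

Lemma extend_noise_integrable c k phi h : 0 <= c -> lipschitz_last c k.+1 phi ->
  mu.-integrable setT (EFin \o (fun y => phi (extend h k.+1 (F (h k, y))))).
Proof.
move=> c0 lip.
apply: (lipschitz_integrable C_gt0 a_gt0 moment_eps (L := c * C)).
  by rewrite mulr_ge0// ltW.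
by move=> y y'; rewrite -mulrA; exact: extend_noise_lipschitz.
Qed.

Lemma image_mdist_lipschitz x x' y y' :
  `|mdist (F (x, y)) (F (x', y)) - mdist (F (x, y')) (F (x', y'))| <=
  2 * C * mdist y y'.
Proof.
have := F_lip x y y'; have := F_lip x' y y'.
have := metric_triangle (F (x, y)) (F (x, y')) (F (x', y)).
have := metric_triangle (F (x, y')) (F (x', y')) (F (x', y)).
have := metric_triangle (F (x, y')) (F (x, y)) (F (x', y')).
have := metric_triangle (F (x, y)) (F (x', y)) (F (x', y')).
rewrite (metric_sym (F (x', y')) (F (x', y))) (metric_sym (F (x, y')) (F (x, y))).
by rewrite ler_norml; lra.
Qed.

Lemma Rintegral_contract x x' :
  \int[mu]_y mdist (F (x, y)) (F (x', y)) <= rho * mdist x x'.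
Proof.
have C20 : 0 <= 2 * C by rewrite mulr_ge0// ltW.
have lip := image_mdist_lipschitz x x'.
have int := lipschitz_integrable C_gt0 a_gt0 moment_eps C20 lip.
rewrite -lee_fin /Rintegral fineK; last exact: integrable_fin_num.
rewrite ge0_integral_distribution; last 2 first.
- by apply/measurable_EFinP; exact: lipschitz_measurable lip.
- by move=> y; rewrite lee_fin mdist_ge0.
by have := F_contract x x'; rewrite unlock.
Qed.

(** A perturbation of h k acts on phi directly, with weight 1, and through
    F (h k, y), with weight c and a mean contraction rho. *)
Lemma integrate_last_lipschitz c k phi : (1 <= k)%N -> 0 <= c ->
  lipschitz_last c k.+1 phi ->
  lipschitz_last (1 + rho * c) k (integrate_last k phi).
Proof.
move=> k1 c0 lip h h'.
have C20 : 0 <= 2 * C by rewrite mulr_ge0// ltW.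
have int_d := lipschitz_integrable C_gt0 a_gt0 moment_eps C20
  (image_mdist_lipschitz (h k) (h' k)).
set D := \sum_(1 <= i < k) mdist (h i) (h' i).
set G := fun y => mdist (F (h k, y)) (F (h' k, y)).
have int_cd : mu.-integrable setT (EFin \o (fun y => c * G y)).
  by apply: eq_integrable (integrableZl measurableT c int_d).
have int_cst : mu.-integrable setT (EFin \o cst (D + mdist (h k) (h' k))).
  exact: finite_measure_integrable_cst.
apply: le_trans (_ : \int[mu]_y (D + mdist (h k) (h' k) + c * G y) <= _).
  apply: le_norm_RintegralB; [exact: extend_noise_integrable lip..| |].
    by apply: eq_integrable (integrableD measurableT int_cst int_cd).
  move=> y; apply: le_trans (lip _ _) _.
  rewrite /extend eqxx lerD2r big_nat_recr//= ltn_eqF// lerD2r.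
  rewrite big_nat [leRHS]big_nat; apply: ler_sum => i /andP[_ ik].
  by rewrite ltn_eqF// ltnS ltnW.
rewrite RintegralD// Rintegral_probability_cst RintegralZl//.
rewrite -addrA lerD2l mulrDl mul1r lerD2l (mulrC rho) -mulrA.
by rewrite ler_wpM2l// Rintegral_contract.
Qed.

(** The exponential moment of phi is computed by integrating the next noise
    first, with the past fixed. *)
Lemma integral_past_step c k phi tau m b : (1 <= k)%N -> 0 <= c ->
  lipschitz_last c k.+1 phi ->
  (forall h, \int[mu]_y (expR (tau * (phi (extend h k.+1 (F (h k, y))) -
       integrate_last k phi h)))%:E <= (expR b)%:E)%E ->
  (\int[P]_w (expR (tau * (phi (Xn ^~ w) - m)))%:E <=
   (expR b)%:E * \int[P]_w (expR (tau * (integrate_last k phi (Xn ^~ w) - m)))%:E)%E.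
Proof.
move=> k1 c0 lip step.
have lip' := integrate_last_lipschitz k1 c0 lip.
have c'0 : 0 <= 1 + rho * c by rewrite addr_ge0// mulr_ge0.
pose psi (u : T_past k * Y) :=
  (expR (tau * (phi (extend (Xn ^~ u.1) k.+1 (F (Xn k u.1, u.2))) - m)))%:E.
pose g (u : T_past k) :=
  ((expR b)%:E * (expR (tau * (integrate_last k phi (Xn ^~ u) - m)))%:E)%E.
have mpsi : measurable_fun setT psi.
  apply/measurable_EFinP; apply: measurableT_comp => //.
  apply: measurable_funM => //; apply: measurable_funB => //.
  apply: (lipschitz_last_measurable (k := k.+1) (c := c)
    (Z := fun i (u : T_past k * Y) =>
      extend (Xn ^~ u.1) k.+1 (F (Xn k u.1, u.2)) i)) => //.
  move=> i /andP[i1 ik]; rewrite /extend; case: eqP => [_|/eqP ik'].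
    apply: measurableT_comp => //; apply: measurable_fun_pair => //.
    apply: (measurableT_comp (f := (Xn k : T_past k -> X))) => //.
    by apply: measurable_chain_past; rewrite // k1 leqnn.
  apply: (measurableT_comp (f := (Xn i : T_past k -> X))) => //.
  by apply: measurable_chain_past; rewrite // i1 -ltnS ltn_neqAle ik'.
have mlast : measurable_fun setT (fun u : T_past k =>
    expR (tau * (integrate_last k phi (Xn ^~ u) - m))).
  apply: measurableT_comp => //.
  apply: measurable_funM => //; apply: measurable_funB => //.
  apply: (lipschitz_last_measurable (k := k)
    (Z := fun i (u : T_past k) => Xn i u) _ _ lip') => //.
  by move=> i ik; exact: measurable_chain_past.
have mg : measurable_fun setT g.
  by apply: measurable_funeM; exact/measurable_EFinP.
have step' u : (\int[distribution P (eps k.+1)]_y psi (u, y) <= g u)%E.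
  rewrite integral_noise//.
  set e := expR (tau * (integrate_last k phi (Xn ^~ u) - m)).
  rewrite (_ : (fun y => psi (u, y)) = fun y => (e%:E * (expR (tau *
      (phi (extend (Xn ^~ u) k.+1 (F (Xn k u, y))) -
       integrate_last k phi (Xn ^~ u))))%:E)%E); last first.
    by apply/funext => y; rewrite /psi /e -EFinM -expRD; congr (expR _)%:E; ring.
  rewrite ge0_integralZl//; last 2 first.
  - apply/measurable_EFinP; apply: measurableT_comp => //.
    apply: measurable_funM => //; apply: measurable_funB => //.
    by have /measurable_int/measurable_EFinP :=
      extend_noise_integrable (Xn ^~ u) c0 lip.
  - by rewrite lee_fin expR_ge0.
  by rewrite /g muleC lee_wpmul2r// lee_fin expR_ge0.
have := independent_tonelli_le
  (W := (to_past eps (Xn 1%N) (noise_times k) : {RV P >-> T_past k})) (Z := eps k.+1)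
  (noise_past_independent k1) mpsi (fun u => expR_ge0 _) mg step'.
(* the history of the chain, extended by its next step, is the history itself *)
have psiE w : psi (w, eps k.+1 w) = (expR (tau * (phi (Xn ^~ w) - m)))%:E.
  rewrite /psi/= (_ : extend _ _ _ = Xn ^~ w)//; apply/funext => i.
  by rewrite /extend; case: eqP => // ->; rewrite (@Xn_chain k.+1).
under eq_integral do rewrite psiE.
move=> /le_trans; apply.
rewrite /g ge0_integralZl//.
apply/measurable_EFinP; apply: (measurableT_comp mlast).
exact: measurable_to_past.
Qed.

Lemma mgf_initial (L q tau : R) (psi : X -> R) : 0 <= L -> 0 <= q -> q < 1 ->
  `|tau| * L <= q * a ->
  (forall x x', `|psi x - psi x'| <= L * mdist x x') ->
  (\int[P]_w (expR (tau * (psi (Xn 1%N w) -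
       \int[distribution P (Xn 1%N)]_x psi x)))%:E <=
   (expR (2 / expR 1 ^+ 2 * (q ^+ 2 / (1 - q)) * K1))%:E)%E.
Proof.
move=> L0 q0 q1 tauL lip; set m := \int[_]_x psi x.
have G_epsE x : G_eps 1 (distribution P (Xn 1%N)) x = G_X1 (distribution P (Xn 1%N)) x.
  by rewrite /G_eps /G_X1; under eq_integral do rewrite mul1r.
have moment1 : (\int[P]_w expeR (a%:E *
    G_eps 1 (distribution P (Xn 1%N)) (Xn 1%N w)) <= K1%:E)%E.
  by under eq_integral do rewrite G_epsE.
apply: le_trans (lipschitz_mgf ltr01 a_gt0 moment1 L0 q0 q1 tauL (psi := psi) _).
  rewrite ge0_integral_distribution//.
  apply/measurable_EFinP; apply: measurableT_comp => //.
  apply: measurable_funM => //; apply: measurable_funB => //.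
  exact: lipschitz_measurable lip.
by move=> x x'; rewrite mul1r.
Qed.

(** Induction on k: at k = 1 only the average over X_1 is left, of a Lipschitz
    function of X_1 (the factor K1), and each later one adds a factor for the
    noise of index k. The center m is the iterated average of phi and has to be
    chosen before tau and s. *)
Lemma chain_mgf n k phi : (1 <= k <= n)%N ->
  lipschitz_last (Kgeom rho (n - k)) k phi ->
  exists m, forall tau s, 0 <= s -> s < 1 -> `|tau| = s * Delta_ rho a n ->
  (\int[P]_w (expR (tau * (phi (Xn ^~ w) - m)))%:E <=
   (expR (2 / expR 1 ^+ 2 * (s ^+ 2 / (1 - s)) *
     (K1 + K2 * \sum_(2 <= i < k.+1) (Kgeom rho (n - i) / Kgeom rho n.-1) ^+ 2)))%:E)%E.
Proof.
have Kn_gt0 j : 0 < Kgeom rho j by exact: Kgeom_gt0.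
have r_bounds i : (1 <= i)%N ->
    0 <= Kgeom rho (n - i) / Kgeom rho n.-1 /\
    Kgeom rho (n - i) / Kgeom rho n.-1 <= 1.
  move=> i1; split; first by rewrite divr_ge0// ltW.
  rewrite ler_pdivrMr// mul1r Kgeom_le//.
  by rewrite -subn1 leq_sub2l.
have scale (tau s : R) i : `|tau| = s * Delta_ rho a n -> `|tau| * Kgeom rho (n - i) =
    s * (Kgeom rho (n - i) / Kgeom rho n.-1) * a.
  by move=> ->; rewrite /Delta_; field; rewrite gt_eqF.
have q_lt1 (s r : R) : 0 <= s -> s < 1 -> 0 <= r /\ r <= 1 -> 0 <= s * r /\ s * r < 1.
  move=> s0 s1 [r0 r1]; split; first exact: mulr_ge0.
  by apply: le_lt_trans s1; rewrite ler_piMr.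
elim: k phi => // -[_|k IH] phi kn lip.
  pose psi x := phi (fun=> x).
  have psi_lip x x' : `|psi x - psi x'| <= Kgeom rho (n - 1) * mdist x x'.
    by have := lip (fun=> x) (fun=> x'); rewrite big_geq// add0r.
  (* a function that is Lipschitz in the coordinate 1 alone depends on it alone *)
  have phiE w : phi (Xn ^~ w) = psi (Xn 1%N w).
    apply/eqP; rewrite -subr_eq0 -normr_eq0 eq_le normr_ge0 andbT.
    by apply: le_trans (lip _ _) _; rewrite big_geq// add0r mdistxx mulr0.
  exists (\int[distribution P (Xn 1%N)]_x psi x) => tau s s0 s1 tauE.
  under eq_integral do rewrite phiE.
  have [q0 q1] := q_lt1 _ _ s0 s1 (r_bounds 1%N isT).
  apply: le_trans (mgf_initial (ltW (Kn_gt0 _)) q0 q1 _ psi_lip) _.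
    by rewrite (scale _ _ _ tauE).
  rewrite lee_fin ler_expR big_geq// mulr0 addr0 subn1 divff ?gt_eqF// mulr1.
  by rewrite lexx.
have k1n : (1 <= k.+1 <= n)%N by rewrite /= ltnW.
have := integrate_last_lipschitz (k := k.+1) isT (ltW (Kn_gt0 _)) lip.
rewrite -KgeomS subnSK// => lip'.
have [m IHm] := IH _ k1n lip'.
exists m => tau s s0 s1 tauE.
have r01 := r_bounds k.+2 isT.
have [q0 q1] := q_lt1 _ _ s0 s1 r01.
set r := Kgeom rho (n - k.+2) / Kgeom rho n.-1 in r01 q0 q1.
set q := s * r in q0 q1.
set b := 2 / expR 1 ^+ 2 * (q ^+ 2 / (1 - q)) * K2.
have step h : (\int[mu]_y (expR (tau * (phi (extend h k.+2 (F (h k.+1, y))) -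
    integrate_last k.+1 phi h)))%:E <= (expR b)%:E)%E.
  apply: (lipschitz_mgf C_gt0 a_gt0 moment_eps (ltW (Kn_gt0 (n - k.+2)%N)) q0 q1).
    by rewrite (scale _ _ _ tauE).
  exact: extend_noise_lipschitz (ltW (Kn_gt0 _)) lip.
apply: le_trans (integral_past_step (k := k.+1) m isT (ltW (Kn_gt0 _)) lip step) _.
apply: le_trans (lee_wpmul2l _ (IHm tau s s0 s1 tauE)) _.
  by rewrite lee_fin expR_ge0.
rewrite -EFinM -expRD lee_fin ler_expR.
rewrite [in leRHS]big_nat_recr//= -/r.
set A := 2 / expR 1 ^+ 2 * (s ^+ 2 / (1 - s)); set Sk := \sum_(_ <= _ < _) _.
have -> : A * (K1 + K2 * (Sk + r ^+ 2)) = A * (K2 * r ^+ 2) + A * (K1 + K2 * Sk).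
  by ring.
rewrite lerD2r.
by apply: ratio_exponent_le; case: r01 => // _ _; rewrite (le_trans ler01).
Qed.

End markov_chain.

(** * Centering at the expectation *)

Section mean_from_exponential_moments.
Context {R : realType}.

(** The line 1 + tau e lies below a function with value 1 and slope 0 at 0. *)
Lemma quadratic_exponent_slope0 (c delta e : R) : 0 <= c -> 0 < delta ->
  (forall tau, `|tau| <= delta -> 1 + tau * e <= expR (c * tau ^+ 2)) -> e = 0.
Proof.
move=> c0 delta0.
suff le0 (x : R) : (forall tau, `|tau| <= delta ->
    1 + tau * x <= expR (c * tau ^+ 2)) -> x <= 0.
  move=> slope; apply/eqP; rewrite eq_le le0//= -oppr_le0 le0// => tau taud.
  by have := slope (- tau); rewrite normrN sqrrN mulNr mulrN; exact.
move=> slope; rewrite leNgt; apply/negP => x0.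
have c1 : 0 < c + 1 by rewrite ltr_wpDl.
(* tau is small enough for e^z <= 1 + 2 z and for 2 c tau < x *)
pose tau := Num.min delta (Num.min (x / (4 * (c + 1))) (1 / (2 * (c + 1)))).
have tau0 : 0 < tau by rewrite !lt_min delta0/= !divr_gt0 ?mulr_gt0.
have taux : tau * (4 * (c + 1)) <= x.
  by rewrite -ler_pdivlMr ?mulr_gt0// !ge_min lexx orbT.
have tau1 : tau * (2 * (c + 1)) <= 1.
  by rewrite -ler_pdivlMr ?mulr_gt0// !ge_min lexx !orbT.
have := slope tau; rewrite gtr0_norm// ge_min lexx => /(_ isT).
set z := c * tau ^+ 2 => slope_tau.
have ctau : 0 <= c * tau by rewrite mulr_ge0// ltW.
have z0 : 0 <= z by rewrite mulr_ge0// sqr_ge0.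
have z2 : z <= 1 / 2.
  have : z <= c * tau by rewrite /z expr2 mulrA ler_piMr//; lra.
  by lra.
have expz : expR z <= 1 + 2 * z.
  have : expR z * (1 - z) <= 1.
    by rewrite -[leRHS](expRxMexpNx_1 z) ler_wpM2l ?expR_ge0// expR_ge1Dx.
  have := expR_gt0 z => ez0 ez1.
  have : expR z <= 2 by nra.
  by nra.
have : tau * x <= tau * (2 * (c * tau)) by rewrite /z in expz; lra.
rewrite ler_pM2l// => xle.
by lra.
Qed.

(** 1 + tau E[Z - m] <= E[e^(tau (Z - m))] by convexity, and the right-hand side
    is 1 + O(tau^2). Integrability of Z is not assumed: it follows from
    |u| <= e^u + e^(-u). *)
Lemma integral_of_quadratic_mgf (d : measure_display) (T : measurableType d)
    (P : probability T R) (Z : T -> R) (m c delta : R) :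
  measurable_fun setT Z -> 0 <= c -> 0 < delta ->
  (forall tau, `|tau| <= delta ->
    (\int[P]_w (expR (tau * (Z w - m)))%:E <= (expR (c * tau ^+ 2))%:E)%E) ->
  (\int[P]_w (Z w)%:E = m%:E)%E.
Proof.
move=> mZ c0 delta0 mgf.
have mW : measurable_fun setT (fun w => Z w - m) by exact: measurable_funB.
have int_exp tau : `|tau| <= delta ->
    P.-integrable setT (EFin \o (fun w => expR (tau * (Z w - m)))).
  move=> taud; apply/integrableP; split.
    by apply/measurable_EFinP; apply: measurableT_comp => //; exact: measurable_funM.
  under eq_integral do rewrite /= ger0_norm ?expR_ge0//.
  exact: le_lt_trans (mgf _ taud) (ltry _).
have int_W : P.-integrable setT (EFin \o (fun w => Z w - m)).
  have intD : P.-integrable setT (EFin \o (fun w =>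
      delta^-1 * (expR (delta * (Z w - m)) + expR (- delta * (Z w - m))))).
    apply: eq_integrable (integrableZl measurableT delta^-1
      (integrableD measurableT (int_exp delta _) (int_exp (- delta) _))) => //.
      by rewrite gtr0_norm.
    by rewrite normrN gtr0_norm.
  apply: le_integrable intD => //; first exact/measurable_EFinP.
  move=> w _ /=; rewrite lee_fin [leRHS]ger0_norm; last first.
    by rewrite mulr_ge0 ?invr_ge0 ?addr_ge0 ?expR_ge0// ltW.
  rewrite ler_pdivlMl// -[X in X * _]gtr0_norm// -normrM.
  rewrite mulNr; set u := delta * _.
  have := expR_ge1Dx u; have := expR_ge1Dx (- u).
  have := expR_ge0 u; have := expR_ge0 (- u).
  by rewrite ler_norml; lra.
have mean0 : \int[P]_w (Z w - m) = 0.
  apply: (quadratic_exponent_slope0 c0 delta0) => tau taud.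
  rewrite -lee_fin; apply: le_trans (mgf _ taud).
  have int_lin : P.-integrable setT (EFin \o (fun w => 1 + tau * (Z w - m))).
    by apply: eq_integrable (integrableD measurableT
      (@finite_measure_integrable_cst _ _ _ P _ 1 measurableT)
      (integrableZl measurableT tau int_W)).
  have int_tau : P.-integrable setT (EFin \o (fun w => tau * (Z w - m))).
    by apply: eq_integrable (integrableZl measurableT tau int_W).
  have -> : (1 + tau * \int[P]_w (Z w - m))%:E =
      (\int[P]_w (1 + tau * (Z w - m))%:E)%E.
    rewrite -RintegralZl// -[X in (X + _)%:E](Rintegral_probability_cst P).
    rewrite -RintegralD//; last exact: finite_measure_integrable_cst.
    by rewrite /Rintegral fineK//; exact: integrable_fin_num.
  apply: le_integral => //; first exact: int_exp.
  by move=> w _; rewrite lee_fin expR_ge1Dx.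
have -> : (\int[P]_w (Z w)%:E = \int[P]_w ((Z w - m)%:E + m%:E))%E.
  by apply: eq_integral => w _; rewrite -EFinD subrK.
rewrite integralD//; last exact: finite_measure_integrable_cst.
rewrite integral_probability_cst -[X in (X + _)%E]fineK; last exact: integrable_fin_num.
by move: mean0; rewrite /Rintegral => ->; rewrite add0e.
Qed.

End mean_from_exponential_moments.

(** * The Bernstein inequality *)

(** Time 1 corresponds to the index 0 of the tuple. *)
Lemma tuple_lipschitz_last (R : realType) (d : measure_display)
    (X : polishMetricType d R) n (f : n.-tuple X -> R) : (1 <= n)%N ->
  (forall x x' : n.-tuple X,
    `|f x - f x'| <= \sum_(i < n) mdist (tnth x i) (tnth x' i)) ->
  lipschitz_last 1 n (fun h => f [tuple h i.+1 | i < n]).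
Proof.
move=> n1 f_lip h h'; apply: le_trans (f_lip _ _) _.
rewrite mul1r -[leRHS](@big_nat_recr _ _ _ n 1 (fun i => mdist (h i) (h' i)))//.
rewrite big_add1/= big_mkord; apply: ler_sum => i _.
by rewrite !tnth_mktuple.
Qed.

Lemma chernoff_mgf (d : measure_display) (R : realType) (T : measurableType d)
    (P : probability T R) (Z : T -> R) (t b x : R) :
  measurable_fun setT Z -> 0 < t ->
  ('E_P[fun w => expR (t * Z w)] <= (expR b)%:E)%E ->
  (P [set w | (x <= Z w)%R] <= (expR (- t * x + b))%:E)%E.
Proof.
move=> mZ t0 mgf.
pose ZR : {RV P >-> R} := HB.pack Z (isMeasurableFun.Build _ _ _ _ Z mZ).
apply: le_trans (chernoff ZR x t0) _.
rewrite mulNr addrC expRD EFinM lee_wpmul2r ?lee_fin ?expR_ge0//.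
apply: le_trans mgf.
rewrite /mmt_gen_fun (_ : expR \o t \o* ZR = fun w => expR (t * Z w))//.
by apply/funext => w /=; rewrite mulrC.
Qed.

Theorem proposition3p2 (R : realType)
  (dT dX dY : measure_display)
  (T : measurableType dT) (P : probability T R)
  (X : polishMetricType dX R) (Y : polishMetricType dY R)
  (eps : nat -> {RV P >-> Y}) (Xn : nat -> {RV P >-> X})
  (F : X * Y -> X) (rho C : R)
  (eps_iid : iid [set i | (1 <= i)%N] eps)
  (X1_indep : independent_of_family [set i | (2 <= i)%N] (Xn 1%N) eps)
  (Xn_chain : forall k, (2 <= k)%N ->
    forall w, Xn k w = F (Xn k.-1 w, eps k w))
  (F_meas : measurable_fun [set: X * Y] F)
  (rho_ge0 : 0 <= rho) (rho_lt1 : rho < 1) (C_gt0 : 0 < C)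
  (F_contract : forall x x' : X,
    ('E_P[fun w => mdist (F (x, eps 1%N w)) (F (x', eps 1%N w))]
      <= (rho * mdist x x')%:E)%E)
  (F_lip : forall (x : X) (y y' : Y),
    mdist (F (x, y)) (F (x, y')) <= C * mdist y y')
  (n : nat) (n_ge1 : (1 <= n)%N)
  (f : n.-tuple X -> R)
  (f_lip : forall x x' : n.-tuple X,
    `|f x - f x'| <= \sum_(i < n) mdist (tnth x i) (tnth x' i))
  (a K1 K2 : R) (a_gt0 : 0 < a) (K1_ge1 : 1 <= K1) (K2_ge1 : 1 <= K2)
  (moment_X1 :
    (\int[P]_w expeR (a%:E * G_X1 (distribution P (Xn 1%N)) (Xn 1%N w))
      <= K1%:E)%E)
  (moment_eps :
    (\int[P]_w expeR (a%:E * G_eps C (distribution P (eps 1%N)) (eps 1%N w))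
      <= K2%:E)%E) :
  let S := centered f Xn in
  let K := Kmoment rho K1 K2 n in
  let Delta := Delta_ rho a n in
  forall b : bool,
    (forall t : R, 0 <= t -> t < Delta ->
      ('E_P[fun w => expR ((-1) ^+ b * t * S w)]
        <= (expR (t ^+ 2 * K * Delta ^- 2 / (1 - t * Delta^-1)))%:E)%E)
    /\
    (forall x : R, 0 < x ->
      (P [set w | (x <= (-1) ^+ b * S w)%R]
        <= (expR (- ((x * Delta) ^+ 2 /
              (2 * K * (1 + Num.sqrt (1 + x * Delta / K)) + x * Delta))))%:E)%E
      /\
      expR (- ((x * Delta) ^+ 2 /
              (2 * K * (1 + Num.sqrt (1 + x * Delta / K)) + x * Delta)))
        <= expR (- ((x * Delta) ^+ 2 / (4 * K + 2 * x * Delta)))).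
Proof.
move=> S K Delta b.
have Kn0 : 0 < Kgeom rho n.-1 := Kgeom_gt0 _ rho_ge0.
have Delta0 : 0 < Delta by rewrite divr_gt0.
have K0 : 0 < K.
  rewrite mulr_gt0 ?divr_gt0 ?exprn_gt0 ?expR_gt0// ltr_pwDl ?(lt_le_trans ltr01)//.
  apply: mulr_ge0; first exact: le_trans ler01 K2_ge1.
  by apply: sumr_ge0 => i _; exact: sqr_ge0.
pose phi (h : nat -> X) := f [tuple h i.+1 | i < n].
have phi_lip : lipschitz_last 1 n phi by exact: tuple_lipschitz_last.
have mphi : measurable_fun setT (fun w => phi (Xn ^~ w)).
  by apply: lipschitz_last_measurable phi_lip _ => // i _; exact: measurable_funP.
have n_le : (1 <= n <= n)%N by rewrite n_ge1/=.
have phi_lip' : lipschitz_last (Kgeom rho (n - n)) n phi.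
  by rewrite subnn /Kgeom big_nat1 expr0.
have [m mgf_m] := chain_mgf eps_iid X1_indep Xn_chain F_meas rho_ge0 C_gt0
  F_contract F_lip a_gt0 K2_ge1 moment_X1 moment_eps n_le phi_lip'.
have exponentE s : 2 / expR 1 ^+ 2 * (s ^+ 2 / (1 - s)) *
     (K1 + K2 * \sum_(2 <= i < n.+1) (Kgeom rho (n - i) / Kgeom rho n.-1) ^+ 2) =
     K * s ^+ 2 / (1 - s).
  by rewrite /K /Kmoment; ring.
have mgf tau s : 0 <= s -> s < 1 -> `|tau| = s * Delta ->
    (\int[P]_w (expR (tau * (phi (Xn ^~ w) - m)))%:E <=
     (expR (K * s ^+ 2 / (1 - s)))%:E)%E.
  by move=> s0 s1 tauE; rewrite -exponentE; exact: mgf_m.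
(* the mean is identified from |tau| <= Delta / 2, where 1 / (1 - s) <= 2 *)
have mean : (\int[P]_w (phi (Xn ^~ w))%:E = m%:E)%E.
  apply: (@integral_of_quadratic_mgf _ _ _ _ _ _ (2 * K / Delta ^+ 2) (Delta / 2)) => //.
  - by rewrite divr_ge0 ?sqr_ge0// mulr_ge0// ltW.
  - by rewrite divr_gt0.
  move=> tau tauD; pose s : R := `|tau| / Delta.
  have s0 : 0 <= s by rewrite divr_ge0// ltW.
  have s2 : s <= 1 / 2 by rewrite ler_pdivrMr//; lra.
  have s1 : s < 1 by lra.
  apply: le_trans (mgf tau s s0 s1 _) _; first by rewrite divfK// gt_eqF.
  rewrite lee_fin ler_expR.
  have -> : 2 * K / Delta ^+ 2 * tau ^+ 2 = K * s ^+ 2 * 2.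
    have <- : `|tau| ^+ 2 = tau ^+ 2 by rewrite -normrX ger0_norm// sqr_ge0.
    by rewrite /s; field; rewrite gt_eqF.
  have s2' : (1 - s)^-1 <= 2 by rewrite -div1r ler_pdivrMr; lra.
  by apply: ler_wpM2l => //; rewrite mulr_ge0 ?(ltW K0)// sqr_ge0.
have SE w : S w = phi (Xn ^~ w) - m.
  by rewrite /S /centered unlock /chain_fun -/phi mean.
have mS : measurable_fun setT S.
  by rewrite (_ : S = fun w => phi (Xn ^~ w) - m); [exact: measurable_funB|exact/funext].
have mgfS t : 0 <= t -> t < Delta ->
    ('E_P[fun w => expR ((-1) ^+ b * t * S w)] <=
     (expR (K * (t / Delta) ^+ 2 / (1 - t / Delta)))%:E)%E.
  move=> t0 tD; rewrite unlock.
  under eq_integral do rewrite SE.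
  apply: mgf; first by rewrite divr_ge0// ltW.
    by rewrite ltr_pdivrMr// mul1r.
  by rewrite normrM normr_sign mul1r ger0_norm// divfK// gt_eqF.
split=> [t t0 tD|x x0].
  have -> : t ^+ 2 * K * Delta ^- 2 = K * (t / Delta) ^+ 2.
    by rewrite (expr_div_n t Delta) [LHS]mulrAC [LHS]mulrC.
  exact: mgfS.
have y0 : 0 < x * Delta by rewrite mulr_gt0.
split; last first.
  by rewrite ler_expR lerN2 -mulrA; exact: bernstein_simplify.
have /= [s0 s1 <-] := bernstein_exponentE K0 y0.
set s := 1 - (Num.sqrt _)^-1 in s0 s1 *.
rewrite [- s * _](_ : _ = - (s * Delta) * x); last by ring.
apply: chernoff_mgf; first by apply: measurable_funM.
  by rewrite mulr_gt0.
under [X in 'E_P[X]%E]eq_fun do rewrite mulrA (mulrC (s * Delta)).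
have /mgfS : 0 <= s * Delta by rewrite mulr_ge0 ?ltW.
by rewrite mulfK ?gt_eqF//; apply; rewrite gtr_pMl.
Qed.
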